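(* Let $N\ge2$, $\mathbf{z}=(z_1>\cdots>z_N)$, and $\mathsf{a}=(\mathsf{a}_1,\ldots,\mathsf{a}_N)\in\mathbb{R}^N$. Put $\bar{\mathsf{y}}_i^N=z_i$ for $i=1,\ldots,N$. There exists exactly one array $\bar{\mathsf{Y}}=\{\bar{\mathsf{y}}_i^k\}_{1\le i\le k\le N-1}$ in the open Gelfand--Tsetlin polytope with top row $\mathbf{z}$ (the deformed $\infty$-corners lattice) satisfying $$\sum_{\substack{1\le j\le k\\ j\ne i}}\frac{1}{\bar{\mathsf{y}}_i^k-\bar{\mathsf{y}}_j^k}-\frac12\sum_{q=1}^{k+1}\frac{1}{\bar{\mathsf{y}}_i^k-\bar{\mathsf{y}}_q^{k+1}}-\frac12\sum_{p=1}^{k-1}\frac{1}{\bar{\mathsf{y}}_i^k-\bar{\mathsf{y}}_p^{k-1}}=\frac{\mathsf{a}_k-\mathsf{a}_{k+1}}{2},\qquad 1\le i\le k\le N-1.$$ Moreover, $\bar{\mathsf{Y}}$ is the unique critical point, as well as the global minimizer, of the effective Hamiltonian $H_{\mathsf{a}}$ in the Gelfand--Tsetlin polytope.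
   Context: The open Gelfand--Tsetlin polytope with top row $\mathbf{z}$ is the set of arrays $\mathbf{Y}=(\mathbf{y}^1,\ldots,\mathbf{y}^{N-1})$, $\mathbf{y}^k=(y_1^k,\ldots,y_k^k)\in\mathbb{R}^k$, such that with $\mathbf{y}^N=\mathbf{z}$ one has strict interlacing $y_1^{k+1}>y_1^k>y_2^{k+1}>\cdots>y_k^k>y_{k+1}^{k+1}$ for all $k=1,\ldots,N-1$. The effective Hamiltonian, defined on it, is $$H_{\mathsf{a}}(\mathbf{Y})=\sum_{k=1}^{N-1}\Bigl[\sum_{1\le i<j\le k}\log(y_i^k-y_j^k)-\frac12\sum_{p=1}^k\sum_{q=1}^{k+1}\log|y_p^k-y_q^{k+1}|-\frac{\mathsf{a}_k-\mathsf{a}_{k+1}}{2}\sum_{i=1}^k y_i^k\Bigr],\qquad \mathbf{y}^N=\mathbf{z}.$$ *)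

(* Defs.v *)
From mathcomp Require Import all_boot all_order all_algebra.
From mathcomp Require Import all_classical all_reals all_analysis.
Set Implicit Arguments.
Unset Strict Implicit.
Unset Printing Implicit Defensive.
Import Order.TTheory GRing.Theory Num.Theory.
Import numFieldNormedType.Exports.
Local Open Scope ring_scope.

(* Levels are numbered by their length, so level k runs over 1, ..., N-1 (and N
   for the top row); the position inside a level, and the index of the tuples
   z and a, start at 0.  Thus y_i^k is [gt_entry z Y k i.-1], and a_k is
   a`_k.-1.  Level 0 has no entries, since 'I_0 is empty. *)
Definition gt_pos (N : nat) : finType := {k : 'I_N & 'I_k}.

Definition gt_array (R : realType) (N : nat) := {ffun gt_pos N -> R}.

(* The array extended by its top row y^N = z; the value is only meaningful for
   i < k <= N. *)
Definition gt_entry (R : realType) (N : nat) (z : N.-tuple R)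
    (Y : gt_array R N) (k i : nat) : R :=
  if (insub k : option 'I_N) is Some k' then
    if (insub i : option 'I_k') is Some i' then
      Y (Tagged (fun k : 'I_N => 'I_k) i')
    else 0
  else z`_i.

Lemma gt_entry_lower (R : realType) (N : nat) (z : N.-tuple R)
    (Y : gt_array R N) (k : 'I_N) (i : 'I_k) :
  gt_entry z Y k i = Y (Tagged (fun k : 'I_N => 'I_k) i).
Proof. by rewrite /gt_entry valK valK. Qed.

Lemma gt_entry_top (R : realType) (N : nat) (z : N.-tuple R)
    (Y : gt_array R N) (i : 'I_N) :
  gt_entry z Y N i = tnth z i.
Proof. by rewrite /gt_entry insubF ?ltnn // (tnth_nth 0). Qed.

Definition open_gt_polytope (R : realType) (N : nat) (z : N.-tuple R)
    (Y : gt_array R N) : Prop :=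
  let y := gt_entry z Y in
  forall k i : nat, (1 <= k < N)%N -> (i < k)%N ->
    y k i < y k.+1 i /\ y k.+1 i.+1 < y k i.

Definition corners_equations (R : realType) (N : nat) (z a : N.-tuple R)
    (Y : gt_array R N) : Prop :=
  let y := gt_entry z Y in
  forall k i : nat, (1 <= k < N)%N -> (i < k)%N ->
    \sum_(j < k | j != i :> nat) (y k i - y k j)^-1
    - 2^-1 * \sum_(q < k.+1) (y k i - y k.+1 q)^-1
    - 2^-1 * \sum_(p < k.-1) (y k i - y k.-1 p)^-1
    = (a`_k.-1 - a`_k) / 2.

Definition effective_hamiltonian (R : realType) (N : nat) (z a : N.-tuple R)
    (Y : gt_array R N) : R :=
  let y := gt_entry z Y in
  \sum_(1 <= k < N)
    (\sum_(i < k) \sum_(j < k | (i < j)%N) ln (y k i - y k j)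
     - 2^-1 * \sum_(p < k) \sum_(q < k.+1) ln `|y k p - y k.+1 q|
     - (a`_k.-1 - a`_k) / 2 * \sum_(i < k) y k i).

Definition gt_update (R : realType) (N : nat) (Y : gt_array R N)
    (p : gt_pos N) (t : R) : gt_array R N :=
  [ffun q => if q == p then t else Y q].

(* All first-order partial derivatives of H exist and vanish at Y. *)
Definition is_critical_point (R : realType) (N : nat) (H : gt_array R N -> R)
    (Y : gt_array R N) : Prop :=
  forall p : gt_pos N, is_derive (Y p) 1 (fun t : R => H (gt_update Y p t)) 0.

Definition is_global_minimizer (R : realType) (N : nat)
    (D : gt_array R N -> Prop) (H : gt_array R N -> R)
    (Y : gt_array R N) : Prop :=
  D Y /\ forall Y' : gt_array R N, D Y' -> H Y <= H Y'.

(* Main.v *)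
Require Import Defs.
From mathcomp Require Import all_boot all_order all_algebra.
From mathcomp Require Import all_classical all_reals all_analysis.
From mathcomp Require Import ring lra.
Import Order.TTheory GRing.Theory Num.Theory.
Import numFieldNormedType.Exports.
Local Open Scope ring_scope.
Set Implicit Arguments.
Unset Strict Implicit.
Unset Printing Implicit Defensive.

(** Up to a linear term and a constant that depends on the top row only, the
    effective Hamiltonian is one half of the sum, over pairs of consecutive
    levels x (n points) and y (n + 1 points), of
      F(x, y) = log Delta(x) + log Delta(y) - sum_(p, q) log |x_p - y_q|,
    where Delta is the Vandermonde product: the pair (k, k + 1) and the pair
    (k - 1, k) each contribute one half of log Delta(y^k).  F is the logarithm
    of the modulus of a Cauchy determinant bordered by a row of ones, and the
    theorem holds because F is convex on interlacing configurations, although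
    its terms log Delta are concave.

    Convexity of F.  The residues w_q of prod (t - x_p) / prod (t - y_q) are
    positive and sum to 1.  The bordered Cauchy matrix, with rows and columns
    scaled by square roots of suitable rho_p > 0 and of w_q, is orthogonal, so
    that B_pq = rho_p w_q / (x_p - y_q)^2, completed by the row w, is doubly
    stochastic ([coupling_row], [coupling_column]).  Product formulas for w and
    rho give F = - (sum log rho + sum log w) / 2.  If B' is the matrix of
    another interlacing configuration (x', y'), then Gibbs' inequality
    sum B log (B' / B) <= 0, summed along rows and columns, becomes
      F(x', y') >= F(x, y) - sum B_pq log ((x'_p - y'_q) / (x_p - y_q)),
    which is [log_cauchy_ge].  Since log t <= t - 1, the right-hand side is at
    least an affine function of (x', y') that agrees with F at (x, y), and it
    is strictly larger unless all differences x_p - y_q are unchanged.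

    Uniqueness.  Summed over the levels, this gives the Hamiltonian an affine
    minorant at every point of the polytope, touching it only there
    ([hamiltonian_subgradient], [excess_eq0]).  The Hamiltonian also has
    partial derivatives, and a differentiable function above an affine one that
    touches it has the same slopes ([partial_subgradient]).  A critical
    point is therefore a strict global minimizer.  The equations of the corners
    lattice say that the partial derivatives vanish ([corners_partial]).

    Existence.  The Hamiltonian is also - (1/2) sum log w over all levels, minus
    a constant and a bounded linear term, with every log w <= 0.  A bound on the
    Hamiltonian thus bounds all the weights w_q from below.  Each w_q is a
    product of ratios of gaps that are at most 1, so the gaps of the top row
    propagate downwards ([weight_gap]) and the sublevel sets lie in a compact
    part of the open polytope, where a minimum is attained. *)

(** * Lagrange interpolation *)

Lemma size_prod_XsubC_ord (F : fieldType) n (f : 'I_n -> F) :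
  size (\prod_i ('X - (f i)%:P)) = n.+1.
Proof.
by rewrite size_prod_XsubC; congr _.+1; rewrite -[RHS]card_ord cardT enumT.
Qed.

(** Both sides have degree at most n and agree at the n + 1 nodes.  The
    other nodes are enumerated by [lift q], which makes the denominators
    products over 'I_n. *)
Lemma lagrange_expansion (F : fieldType) n (y : 'I_n.+1 -> F) (f : {poly F}) :
  injective y -> (size f <= n.+1)%N ->
  f = \sum_q (f.[y q] / \prod_p (y q - y (lift q p))) *:
        \prod_p ('X - (y (lift q p))%:P).
Proof.
move=> yinj sf; set g := (X in _ = X).
have sg : (size g <= n.+1)%N.
  apply: (leq_trans (size_sum _ _ _)); apply/bigmax_leqP => q _.
  apply: leq_trans (size_scale_leq _ _) _.
  by rewrite size_prod_XsubC_ord.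
have gy q : g.[y q] = f.[y q].
  rewrite horner_sum (bigD1 q) //= [X in _ + X]big1 ?addr0 => [|r rq].
    rewrite hornerZ horner_prod.
    under [X in _ / _ * X]eq_bigr do rewrite hornerXsubC.
    rewrite divfK //; apply/prodf_neq0 => p _.
    by rewrite subr_eq0 (inj_eq yinj) neq_lift.
  rewrite hornerZ horner_prod.
  have [p ->] : exists p, q = lift r p.
    by case: (unliftP r q) rq => [p ->|->]; [exists p|rewrite eqxx].
  by rewrite [X in _ * X](bigD1 p) //= hornerXsubC subrr mul0r mulr0.
apply/eqP; rewrite -subr_eq0; apply/eqP.
apply: (@roots_geq_poly_eq0 _ _ [seq y q | q <- enum 'I_n.+1]).
- apply/allP => _ /mapP[q _ ->].
  by rewrite /root hornerD hornerN gy subrr.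
- by rewrite map_inj_uniq ?enum_uniq.
- rewrite size_map size_enum_ord (leq_trans (size_polyD _ _)) //.
  by rewrite size_polyN geq_max sf sg.
Qed.

(** The basis polynomials are monic of degree n. *)
Lemma lagrange_coef (F : fieldType) n (y : 'I_n.+1 -> F) (f : {poly F}) :
  injective y -> (size f <= n.+1)%N ->
  \sum_q f.[y q] / \prod_p (y q - y (lift q p)) = f`_n.
Proof.
move=> yinj sf; rewrite [in RHS](lagrange_expansion yinj sf) coef_sum.
apply: eq_bigr => q _; rewrite coefZ.
have := monicP (monic_prod_XsubC (index_enum 'I_n) xpredT (y \o lift q)).
by rewrite lead_coefE size_prod_XsubC_ord /= => ->; rewrite mulr1.
Qed.

(** The partial fraction decomposition of f / prod (X - y_q), evaluated
    at t. *)
Lemma lagrange_cauchy (F : fieldType) n (y : 'I_n.+1 -> F) (f : {poly F}) t :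
  injective y -> (size f <= n.+1)%N -> (forall q, t != y q) ->
  \sum_q f.[y q] / \prod_p (y q - y (lift q p)) / (t - y q)
  = f.[t] / \prod_q (t - y q).
Proof.
move=> yinj sf ty; rewrite [in RHS](lagrange_expansion yinj sf) horner_sum.
rewrite mulr_suml; apply: eq_bigr => q _; rewrite hornerZ horner_prod.
under [X in _ / _ * X / _]eq_bigr do rewrite hornerXsubC.
rewrite (bigD1_ord q) //=.
have h : \prod_(i < n) (t - y (lift q i)) != 0.
  by apply/prodf_neq0 => p _; rewrite subr_eq0.
have h' : t - y q != 0 by rewrite subr_eq0.
rewrite -!mulrA; congr (_ * _); congr (_ * _).
by rewrite invfM mulrC divfK.
Qed.

(** * The coupling of two interlacing sequences *)

Section Interlaced.
Variables (R : realType).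
Implicit Types (n : nat).

(** All pairs are compared, not only neighbours, since the sign of each
    x_p - y_q is what the arguments below use. *)
Definition interlaced n (x : 'I_n -> R) (y : 'I_n.+1 -> R) :=
  forall (p : 'I_n) (q : 'I_n.+1), if (q <= p)%N then x p < y q else y q < x p.

(** The residue at y_q of prod (t - x_p) / prod (t - y_r); the factors are
    paired so that each of them lies in ]0, 1]. *)
Definition weight n (x : 'I_n -> R) (y : 'I_n.+1 -> R) q :=
  \prod_p ((y q - x p) / (y q - y (lift q p))).

(** The normalization that makes the row p of the coupling sum to 1; up to
    sign, it is the residue at x_p of prod (t - y_q) / prod (t - x_j). *)
Definition coweight n (x : 'I_n -> R) (y : 'I_n.+1 -> R) p :=
  (\sum_q weight x y q / (x p - y q) ^+ 2)^-1.

Lemma interlaced_of_adjacent n (x y : nat -> R) :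
  (forall i, (i < n)%N -> x i < y i /\ y i.+1 < x i) ->
  interlaced (fun p : 'I_n => x p) (fun q : 'I_n.+1 => y q).
Proof.
move=> xy.
have mono d i : (i + d <= n)%N -> y (i + d)%N <= y i.
  elim: d => [|d IH]; rewrite ?addn0 // addnS => id_n.
  have [h1 h2] := xy _ id_n.
  by rewrite (le_trans _ (IH (ltnW id_n))) // ltW // (lt_trans h2).
have mono' i j : (i <= j)%N -> (j <= n)%N -> y j <= y i.
  by move=> ij jn; rewrite -(subnKC ij) mono // subnKC.
move=> p q; case: ifPn => [qp|]; last rewrite -ltnNge => pq.
  exact: lt_le_trans (xy p (ltn_ord p)).1 (mono' _ _ qp (ltnW (ltn_ord p))).
apply: le_lt_trans (xy p (ltn_ord p)).2.
by rewrite mono' // -ltnS.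
Qed.

Lemma interlaced_decr n (x : 'I_n -> R) y : interlaced x y ->
  forall q r : 'I_n.+1, (q < r)%N -> y r < y q.
Proof.
move=> h q r qr; have qn : (q < n)%N by rewrite (leq_trans qr) // -ltnS.
have := h (Ordinal qn) q; have := h (Ordinal qn) r => /=.
by rewrite leqnn leqNgt qr /=; apply: lt_trans.
Qed.

Lemma interlaced_lower_decr n (x : 'I_n -> R) y : interlaced x y ->
  forall p s : 'I_n, (p < s)%N -> x s < x p.
Proof.
move=> h p s ps; have := h s (lift ord0 p); have := h p (lift ord0 p).
by rewrite lift0 ps ltnn => h1 h2; apply: lt_trans h2 h1.
Qed.

Lemma decr_inj n (y : 'I_n -> R) :
  (forall q r : 'I_n, (q < r)%N -> y r < y q) -> injective y.
Proof.
move=> h q r e; apply: ord_inj.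
by have [/h|/h|//] := ltngtP q r; rewrite e ltxx.
Qed.

Section Pair.
Variables (n : nat) (x : 'I_n -> R) (y : 'I_n.+1 -> R).
Hypothesis xy : interlaced x y.
Local Notation w := (weight x y).
Local Notation rho := (coweight x y).

Let yinj : injective y := decr_inj (interlaced_decr xy).
Let xinj : injective x := decr_inj (interlaced_lower_decr xy).

Lemma interlaced_neq p q : x p != y q.
Proof.
by have := xy p q; case: ifP => _ /lt_eqF; [|rewrite eq_sym] => ->.
Qed.

Lemma weight_factor_gt0 q p : 0 < (y q - x p) / (y q - y (lift q p)).
Proof.
have [qp|pq] := leqP q p.
  apply: divr_gt0; rewrite subr_gt0.
    by have := xy p q; rewrite qp.
  by apply: (interlaced_decr xy); rewrite /= /bump qp add1n ltnS.
rewrite -mulrNN -invrN !opprB; apply: divr_gt0; rewrite subr_gt0.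
  by have := xy p q; rewrite (leqNgt q) pq.
by apply: (interlaced_decr xy); rewrite /= /bump (leqNgt q) pq.
Qed.

(** The point x_p separates y_q from y_(lift q p), the p-th of the other
    points of y. *)
Lemma weight_factor_le1 q p : (y q - x p) / (y q - y (lift q p)) <= 1.
Proof.
have [qp|pq] := leqP q p.
  rewrite ler_pdivrMr ?subr_gt0; last first.
    by apply: (interlaced_decr xy); rewrite /= /bump qp add1n ltnS.
  rewrite mul1r lerD2l lerN2; apply: ltW.
  by have := xy p (lift q p); rewrite /= /bump qp add1n ltnn.
rewrite -mulrNN -invrN !opprB ler_pdivrMr ?subr_gt0; last first.
  by apply: (interlaced_decr xy); rewrite /= /bump (leqNgt q) pq.
rewrite mul1r lerD2r; apply: ltW.
by have := xy p (lift q p); rewrite /= /bump (leqNgt q) pq leqnn.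
Qed.

Lemma weight_gt0 q : 0 < w q.
Proof. by apply: prodr_gt0 => p _; apply: weight_factor_gt0. Qed.

Lemma weight_le_factor q p : w q <= (y q - x p) / (y q - y (lift q p)).
Proof.
rewrite /weight (bigD1 p) //= ger_pMr ?weight_factor_gt0 //.
by apply: prodr_ile1 => j _; rewrite weight_factor_le1 ltW ?weight_factor_gt0.
Qed.

Lemma weight_le1 q : w q <= 1.
Proof.
by apply: prodr_ile1 => j _; rewrite weight_factor_le1 ltW ?weight_factor_gt0.
Qed.

Lemma coweight_gt0 p : 0 < rho p.
Proof.
rewrite invr_gt0 big_ord_recl ltr_wpDr //.
  by apply: sumr_ge0 => q _; rewrite divr_ge0 ?sqr_ge0 // ltW ?weight_gt0.
by rewrite divr_gt0 ?weight_gt0 // exprn_even_gt0 //= subr_eq0 interlaced_neq.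
Qed.

Local Notation sub_poly p := (\prod_(j | j != p) ('X - (x j)%:P)).

Lemma weightE q :
  w q = (\prod_p ('X - (x p)%:P)).[y q] / \prod_p (y q - y (lift q p)).
Proof.
rewrite /weight prodf_div horner_prod; congr (_ / _).
by apply: eq_bigr => p _; rewrite hornerXsubC.
Qed.

Lemma weight_sub_poly p q :
  (sub_poly p).[y q] / \prod_s (y q - y (lift q s)) = - (w q / (x p - y q)).
Proof.
rewrite weightE [in RHS](bigD1 p) //= hornerM hornerXsubC.
have h : y q - x p != 0 by rewrite subr_eq0 eq_sym interlaced_neq.
rewrite -[x p - y q]opprB invrN mulrN opprK [_ * _.[_]]mulrC -!mulrA.
by congr (_ * _); rewrite mulrCA divff // mulr1.
Qed.

Lemma size_sub_poly p : size (sub_poly p) = n.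
Proof.
rewrite -big_filter size_prod_XsubC size_filter.
have := cardC1 p; rewrite card_ord cardE /enum_mem size_filter => ->.
by case: n p => [[]|].
Qed.

(** The coefficient of degree n of the monic polynomial prod (X - x_p). *)
Lemma sum_weight : \sum_q w q = 1.
Proof.
under eq_bigr do rewrite weightE.
have s : size (\prod_p ('X - (x p)%:P)) = n.+1.
  by rewrite size_prod_XsubC_ord.
rewrite lagrange_coef ?s //.
have := monicP (monic_prod_XsubC (index_enum 'I_n) xpredT x).
by rewrite lead_coefE s.
Qed.

(** The polynomial prod_(j != p) (X - x_j) has degree less than n. *)
Lemma sum_weight_cauchy p : \sum_q w q / (x p - y q) = 0.
Proof.
apply/eqP; rewrite -oppr_eq0 -sumrN; apply/eqP.
under eq_bigr do rewrite -weight_sub_poly.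
by rewrite lagrange_coef ?size_sub_poly // nth_default ?size_sub_poly.
Qed.

(** For s != p the right-hand side vanishes: distinct rows of the Cauchy
    matrix are orthogonal for the weights w.  For s = p it gives the product
    formula for the normalization rho_p. *)
Lemma sum_weight_cauchy2 p s :
  \sum_q w q / (x p - y q) / (x s - y q)
  = - (\prod_(j | j != p) (x s - x j) / \prod_q (x s - y q)).
Proof.
apply: oppr_inj; rewrite opprK -sumrN.
under [LHS]eq_bigr do rewrite -mulNr -weight_sub_poly.
rewrite lagrange_cauchy ?size_sub_poly //; last exact: interlaced_neq.
rewrite horner_prod; congr (_ / _).
by apply: eq_bigr => j _; rewrite hornerXsubC.
Qed.

Lemma coweightE p :
  rho p * \prod_(j | j != p) (x p - x j) = - \prod_q (x p - y q).
Proof.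
have -> : rho p = (\sum_q w q / (x p - y q) / (x p - y q))^-1.
  by congr (_^-1); apply: eq_bigr => q _; rewrite -mulrA -invfM.
rewrite sum_weight_cauchy2 invrN mulNr invfM invrK; congr (- _).
rewrite mulrAC mulVf ?mul1r //; apply/prodf_neq0 => j jp.
by rewrite subr_eq0 (inj_eq xinj) eq_sym.
Qed.

Definition coupling p q := rho p * w q / (x p - y q) ^+ 2.

Lemma coupling_gt0 p q : 0 < coupling p q.
Proof.
rewrite !mulr_gt0 ?coweight_gt0 ?weight_gt0 // invr_gt0 exprn_even_gt0 //=.
by rewrite subr_eq0 interlaced_neq.
Qed.

Lemma coupling_row p : \sum_q coupling p q = 1.
Proof.
under eq_bigr do rewrite /coupling -mulrA.
rewrite -mulr_sumr mulVf // -invr_eq0.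
by rewrite gt_eqF // coweight_gt0.
Qed.

(** The bordered Cauchy matrix A has the right inverse B, its transpose
    scaled by the w_q and the rho_p; B is then also a left
    inverse, and the diagonal of B A is the claim. *)
Lemma coupling_column q : w q + \sum_p coupling p q = 1.
Proof.
(* The row 0 of A is the border of ones. *)
pose A := \matrix_(i < n.+1, r < n.+1)
  (if unlift ord0 i is Some p then (x p - y r)^-1 else 1).
pose B := \matrix_(r < n.+1, i < n.+1)
  (w r * if unlift ord0 i is Some p then rho p / (x p - y r) else 1).
suff /mulmx1C/matrixP/(_ q q) : A *m B = 1%:M.
  rewrite !mxE eqxx big_ord_recl /= !mxE unlift_none mulr1 mulr1n => <-.
  congr (_ + _); first by rewrite mulr1.
  apply: eq_bigr => p _; rewrite !mxE liftK.
  by rewrite /coupling expr2 invfM; ring.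
apply/matrixP => i j; rewrite !mxE.
case: (unliftP ord0 i) => [p|] ->; case: (unliftP ord0 j) => [s|] ->.
- rewrite (inj_eq lift_inj).
  under eq_bigr do rewrite !mxE !liftK.
  have [->|ps] := eqVneq p s.
    rewrite -(coupling_row s); apply: eq_bigr => r _.
    by rewrite /coupling expr2 invfM; ring.
  transitivity (rho s * \sum_r w r / (x p - y r) / (x s - y r)).
    by rewrite mulr_sumr; apply: eq_bigr => r _; ring.
  rewrite sum_weight_cauchy2 (bigD1 s) 1?eq_sym //= subrr.
  by rewrite !mul0r oppr0 mulr0.
- rewrite eq_sym (negbTE (neq_lift _ _)); apply: etrans (sum_weight_cauchy p).
  by apply: eq_bigr => r _; rewrite !mxE liftK unlift_none; ring.
- rewrite (negbTE (neq_lift _ _)).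
  transitivity (rho s * \sum_r w r / (x s - y r)).
    by rewrite mulr_sumr; apply: eq_bigr => r _;
      rewrite !mxE liftK unlift_none; ring.
  by rewrite sum_weight_cauchy mulr0.
- rewrite eqxx; apply: etrans sum_weight.
  by apply: eq_bigr => r _; rewrite !mxE unlift_none mul1r mulr1.
Qed.

End Pair.
End Interlaced.

(** * The logarithm of a bordered Cauchy determinant *)

Section LogPotential.
Variables (R : realType).
Implicit Types (n : nat).

Definition log_vandermonde n (y : 'I_n -> R) :=
  \sum_(i < n) \sum_(j < n | (i < j)%N) ln (y i - y j).

Definition log_cross n (x : 'I_n -> R) (y : 'I_n.+1 -> R) :=
  \sum_p \sum_q ln `|x p - y q|.

Lemma ln_prod (I : Type) (r : seq I) (P : pred I) (F : I -> R) :
  (forall i, P i -> 0 < F i) ->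
  ln (\prod_(i <- r | P i) F i) = \sum_(i <- r | P i) ln (F i).
Proof.
move=> F0.
suff [] : 0 < \prod_(i <- r | P i) F i /\
  ln (\prod_(i <- r | P i) F i) = \sum_(i <- r | P i) ln (F i) by [].
apply: (big_ind2 (fun a b => 0 < a /\ ln a = b)) => [|a b c d [a0 ab] [c0 cd]|].
- by rewrite ltr01 ln1.
- by rewrite mulr_gt0 // lnM ?posrE // ab cd.
- by move=> i /F0.
Qed.

Lemma ln_norm_prod (I : Type) (r : seq I) (P : pred I) (F : I -> R) :
  (forall i, P i -> F i != 0) ->
  ln `|\prod_(i <- r | P i) F i| = \sum_(i <- r | P i) ln `|F i|.
Proof.
by move=> F0; rewrite normr_prod ln_prod // => i /F0; rewrite normr_gt0.
Qed.

Lemma ln_norm_div (a b : R) : a != 0 -> b != 0 ->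
  ln `|a / b| = ln `|a| - ln `|b|.
Proof. by move=> a0 b0; rewrite normf_div ln_div // posrE normr_gt0. Qed.

Lemma sum_neq_sym n (s : 'I_n -> 'I_n -> R) : (forall i j, s i j = s j i) ->
  \sum_i \sum_(j | j != i) s i j = 2 * \sum_(i < n) \sum_(j < n | (i < j)%N) s i j.
Proof.
move=> sC.
transitivity (\sum_(i < n) (\sum_(j < n | (i < j)%N) s i j + \sum_(j < n | (j < i)%N) s i j)).
  apply: eq_bigr => i _; rewrite (bigID (fun j : 'I_n => (i < j)%N)) /=.
  by congr (_ + _); apply: eq_bigl => j; rewrite -(inj_eq val_inj) /=;
    case: ltngtP.
rewrite big_split /= mulrDl mul1r; congr (_ + _).
rewrite (exchange_big_dep predT) //=.
by apply: eq_bigr => i _; apply: eq_bigr => j _; apply: sC.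
Qed.

Lemma sum_lift n (q : 'I_n.+1) (f : 'I_n.+1 -> R) :
  \sum_p f (lift q p) = \sum_(r | r != q) f r.
Proof.
apply: (addrI (f q)); transitivity (\sum_r f r).
  by rewrite (bigD1_ord q (P := xpredT)).
by rewrite (bigD1 q).
Qed.

Lemma log_vandermonde_norm n (y : 'I_n -> R) :
  (forall q r : 'I_n, (q < r)%N -> y r < y q) ->
  \sum_i \sum_(j | j != i) ln `|y i - y j| = 2 * log_vandermonde y.
Proof.
move=> decr; rewrite sum_neq_sym; last by move=> i j; rewrite distrC.
congr (_ * _); apply: eq_bigr => i _; apply: eq_bigr => j ij.
by rewrite gtr0_norm // subr_gt0 decr.
Qed.

Lemma sum_ln_weight n (x : 'I_n -> R) y : interlaced x y ->
  \sum_q ln (weight x y q) = log_cross x y - 2 * log_vandermonde y.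
Proof.
move=> xy; have decr := interlaced_decr xy.
rewrite -log_vandermonde_norm // /log_cross exchange_big -sumrB /=.
apply: eq_bigr => q _; rewrite ln_prod; last first.
  by move=> p _; exact: weight_factor_gt0.
rewrite -(sum_lift q (fun r => ln `|y q - y r|)) -sumrB.
apply: eq_bigr => p _; rewrite -[X in ln X]gtr0_norm ?weight_factor_gt0 //.
rewrite ln_norm_div; last 2 first.
- by rewrite subr_eq0 eq_sym (interlaced_neq xy).
- by rewrite subr_eq0 (inj_eq (decr_inj decr)) neq_lift.
by rewrite [`|y q - x p|]distrC.
Qed.

Lemma sum_ln_coweight n (x : 'I_n -> R) y : interlaced x y ->
  \sum_p ln (coweight x y p) = log_cross x y - 2 * log_vandermonde x.
Proof.
move=> xy; have decr := interlaced_lower_decr xy.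
rewrite -log_vandermonde_norm // -sumrB; apply: eq_bigr => p _.
have x0 j : j != p -> x p - x j != 0.
  by rewrite subr_eq0 (inj_eq (decr_inj decr)) eq_sym.
have y0 q : x p - y q != 0 by rewrite subr_eq0 (interlaced_neq xy).
have /(congr1 (fun a => ln `|a|)) := coweightE xy p.
rewrite normrN normrM lnM ?posrE ?normr_gt0 //; last 2 first.
- by rewrite gt_eqF ?coweight_gt0.
- exact/prodf_neq0.
rewrite ln_norm_prod // ln_norm_prod // gtr0_norm ?coweight_gt0 // => <-.
by rewrite addrK.
Qed.

(** One term of Gibbs' inequality: log t <= t - 1 at t = c / b. *)
Lemma gibbs (b c : R) : 0 < b -> 0 < c -> b * (ln c - ln b) <= c - b.
Proof.
move=> b0 c0; rewrite -ln_div ?posrE //.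
rewrite -ler_pdivlMl // mulrBr [b^-1 * c]mulrC mulVf ?gt_eqF //.
have := @le_ln1Dx R (c / b - 1); rewrite addrCA subrr addr0; apply.
by rewrite ltrBrDr addNr divr_gt0.
Qed.

Lemma ln_coupling n (x : 'I_n -> R) y p q : interlaced x y ->
  ln (coupling x y p q) =
  ln (coweight x y p) + ln (weight x y q) - 2 * ln `|x p - y q|.
Proof.
move=> xy; have rho0 := coweight_gt0 xy p; have w0 := weight_gt0 xy q.
have d0 : 0 < `|x p - y q| by rewrite normr_gt0 subr_eq0 (interlaced_neq xy).
rewrite /coupling -real_normK ?num_real // ln_div ?posrE ?exprn_gt0 ?mulr_gt0 //.
by rewrite lnM ?posrE // lnXn // mulr_natl.
Qed.

Definition log_cauchy n (x : 'I_n -> R) (y : 'I_n.+1 -> R) :=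
  log_vandermonde x + log_vandermonde y - log_cross x y.

(** Gibbs' inequality for the two doubly stochastic matrices.  The
    logarithm of a quotient of couplings is a row term plus a column term minus
    2 log of the ratio of the differences; row and column sums equal to 1 turn
    the first two into the variation of - 2 F. *)
Lemma log_cauchy_ge n (x x' : 'I_n -> R) y y' :
  interlaced x y -> interlaced x' y' ->
  log_cauchy x y
  - \sum_p \sum_q coupling x y p q * ln ((x' p - y' q) / (x p - y q))
  <= log_cauchy x' y'.
Proof.
move=> xy xy'.
pose w := weight x y; pose w' := weight x' y'.
pose B := coupling x y; pose B' := coupling x' y'.
pose lw q := ln (w' q) - ln (w q).
pose lr p := ln (coweight x' y' p) - ln (coweight x y p).
pose k p q := ln ((x' p - y' q) / (x p - y q)).
have lE n0 (a : 'I_n0 -> R) b : interlaced a b ->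
  log_cauchy a b
  = - (\sum_p ln (coweight a b p) + \sum_q ln (weight a b q)) / 2.
  move=> ab; rewrite sum_ln_weight // sum_ln_coweight // /log_cauchy.
  by field.
have kE p q : k p q = ln `|x' p - y' q| - ln `|x p - y q|.
  rewrite -ln_norm_div ?subr_eq0 ?interlaced_neq // ger0_norm //.
  have := xy p q; have := xy' p q; case: ifP => _.
    by move=> h h'; rewrite -mulrNN -invrN divr_ge0 // oppr_ge0 subr_le0 ltW.
  by move=> h h'; rewrite divr_ge0 // subr_ge0 ltW.
have BE p q : ln (B' p q) - ln (B p q) = lr p + lw q - 2 * k p q.
  by rewrite kE /B /B' /lr /lw !ln_coupling // /w /w'; ring.
have : \sum_q w q * lw q + \sum_p \sum_q B p q * (lr p + lw q - 2 * k p q) <= 0.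
  have sum0 : \sum_q (w' q - w q) + \sum_p \sum_q (B' p q - B p q) = 0.
    under [X in _ + X = _]eq_bigr do rewrite sumrB !coupling_row // subrr.
    by rewrite [X in _ + X]big1 // addr0 sumrB !sum_weight // subrr.
  rewrite -[leRHS]sum0; apply: lerD; apply: ler_sum => i _.
    by rewrite gibbs ?weight_gt0.
  by apply: ler_sum => q _; rewrite -BE gibbs ?coupling_gt0.
have -> : \sum_p \sum_q B p q * (lr p + lw q - 2 * k p q)
  = \sum_p (\sum_q B p q) * lr p + \sum_q (\sum_p B p q) * lw q
    - 2 * \sum_p \sum_q B p q * k p q.
  under [X in _ = _ + X - _]eq_bigr do rewrite mulr_suml.
  rewrite [X in _ = _ + X - _]exchange_big mulr_sumr -big_split -sumrB /=.
  apply: eq_bigr => p _.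
  rewrite mulr_suml mulr_sumr -big_split -sumrB /=; apply: eq_bigr => q _.
  by ring.
have -> : \sum_p (\sum_q B p q) * lr p = \sum_p lr p.
  by apply: eq_bigr => p _; rewrite coupling_row // mul1r.
have lwE : \sum_q w q * lw q + \sum_q (\sum_p B p q) * lw q = \sum_q lw q.
  rewrite -big_split; apply: eq_bigr => q _.
  by rewrite /= -mulrDl coupling_column // mul1r.
rewrite !lE //.
have -> : \sum_p ln (coweight x' y' p)
    = \sum_p ln (coweight x y p) + \sum_p lr p.
  by rewrite sumrB subrKC.
have -> : \sum_q ln (w' q) = \sum_q ln (w q) + \sum_q lw q.
  by rewrite sumrB subrKC.
by lra.
Qed.

Lemma ln_le_sub1 (t : R) : 0 < t -> ln t <= t - 1.
Proof.
by move=> t0; have := @gibbs 1 t ltr01 t0; rewrite ln1 subr0 mul1r.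
Qed.

Lemma ln_lt_sub1 (t : R) : 0 < t -> t != 1 -> ln t < t - 1.
Proof.
move=> t0 t1; rewrite -ltr_expR lnK ?posrE //.
by have := @expR_gt1Dx R (t - 1); rewrite subr_eq0 addrCA subrr addr0; apply.
Qed.

End LogPotential.

(** * Sums, derivatives and continuity *)

Section Preliminaries.
Variables (R : realType).

Lemma sum_nat_single m n k (f : nat -> R) : (m <= k < n)%N ->
  (forall l, (m <= l < n)%N -> l != k -> f l = 0) ->
  \sum_(m <= l < n) f l = f k.
Proof.
move=> kmn f0; rewrite (bigD1_seq k) ?mem_index_iota ?iota_uniq //=.
rewrite big_seq_cond big1 ?addr0 // => l; rewrite mem_index_iota.
by case/andP; exact: f0.
Qed.

Lemma sum_unit n i (F : 'I_n -> R) (ilt : (i < n)%N) :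
  \sum_(j < n) (i == j)%:R * F j = F (Ordinal ilt).
Proof.
rewrite (bigD1 (Ordinal ilt)) //= eqxx mul1r big1 ?addr0 // => j ne.
by rewrite (negbTE (_ : i != j)) ?mul0r // eq_sym; apply: contraNneq ne => e;
  apply/eqP/val_inj.
Qed.

(** The summand is symmetric in s and t, so the sum over s < t is half the
    sum over s != t, and each of the two indicators contributes the same. *)
Lemma sum_pair_unit n i (y : 'I_n -> R) (ilt : (i < n)%N) :
  \sum_(s < n) \sum_(t < n | (s < t)%N) ((i == s)%:R - (i == t)%:R) / (y s - y t)
  = \sum_(t < n | t != i :> nat) (y (Ordinal ilt) - y t)^-1.
Proof.
pose S (s t : 'I_n) : R := ((i == s :> nat)%:R - (i == t :> nat)%:R) / (y s - y t).
have SC s t : S s t = S t s.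
  by rewrite /S -(opprB (y t)) -(opprB (_ == _)%:R) invrN mulrNN.
apply: (@mulfI _ 2) => //; rewrite -(sum_neq_sym SC) mulrDl mul1r.
pose T (s t : 'I_n) := (i == s)%:R * (y s - y t)^-1.
have <- : \sum_(s < n) \sum_(t | t != s) T s t
    = \sum_(t < n | t != i :> nat) (y (Ordinal ilt) - y t)^-1.
  under eq_bigr do rewrite -mulr_sumr; rewrite (sum_unit _ ilt).
  by apply: eq_bigl => t; rewrite -(inj_eq val_inj).
rewrite [X in _ = X + _](exchange_big_dep predT) //= -big_split /=.
apply: eq_bigr => s _.
rewrite [X in _ = X + _](eq_bigl (fun t => t != s)); last first.
  by move=> t; rewrite eq_sym.
rewrite -big_split; apply: eq_bigr => t _ /=.
by rewrite /S /T -(opprB (y t)) invrN; ring.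
Qed.

(** The reciprocal of 1 + sum 1 / f works, which avoids a minimum over a
    possibly empty type. *)
Lemma exists_lower_bound (I : finType) (f : I -> R) : (forall i, 0 < f i) ->
  exists2 e, 0 < e & forall i, e <= f i.
Proof.
move=> f0; exists (1 + \sum_i (f i)^-1)^-1 => [|i].
  by rewrite invr_gt0 ltr_wpDr // sumr_ge0 // => i _; rewrite invr_ge0 ltW.
rewrite -[leRHS]invrK lef_pV2 ?posrE ?invr_gt0 //.
  rewrite (bigD1 i) //= addrCA lerDl addr_ge0 // sumr_ge0 // => j _.
  by rewrite invr_ge0 ltW.
by rewrite ltr_wpDr // sumr_ge0 // => j _; rewrite invr_ge0 ltW.
Qed.

Lemma is_derive_big (I : eqType) (r : seq I) (P : pred I) (h : I -> R -> R)
    (t : R) (dh : I -> R) :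
  (forall i, i \in r -> P i -> is_derive t 1 (h i) (dh i)) ->
  is_derive t 1 (fun s => \sum_(i <- r | P i) h i s) (\sum_(i <- r | P i) dh i).
Proof.
elim: r => [|i r IH] hr.
  rewrite big_nil (_ : (fun _ => _) = cst 0); first exact: is_derive_cst.
  by apply/funext => s; rewrite big_nil.
have {}IH := IH (fun j jr => hr j (@mem_behead _ (i :: r) j jr)).
have := hr i (mem_head i r); rewrite big_cons; case: ifPn => Pi di.
  rewrite (_ : (fun _ => _) = h i + (fun s => \sum_(i <- r | P i) h i s)).
    exact: is_deriveD (di isT) IH.
  by apply/funext => s; rewrite big_cons Pi.
rewrite (_ : (fun _ => _) = (fun s => \sum_(i <- r | P i) h i s)) //.
by apply/funext => s; rewrite big_cons (negbTE Pi).
Qed.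

Lemma is_derive_ext (f g : R -> R) (t d : R) :
  is_derive t 1 f d -> f =1 g -> is_derive t 1 g d.
Proof. by move=> df /funext <-. Qed.

Lemma is_derive_affine (c d t0 : R) :
  is_derive t0 1 (fun t => c + (t - t0) * d) d.
Proof.
apply: is_derive_eq.
by rewrite /GRing.scale /= subrr; ring.
Qed.

Lemma is_derive_ln_affine (c d t0 : R) : 0 < c ->
  is_derive t0 1 (fun t => ln (c + (t - t0) * d)) (d / c).
Proof.
move=> c0; rewrite mulrC.
apply: (@is_derive1_comp R (@ln R) (fun t => c + (t - t0) * d)).
  by rewrite subrr mul0r addr0; exact: is_derive1_ln.
exact: is_derive_affine.
Qed.

(** Writing ln |u| as ln (u^2) / 2 avoids a case analysis on the sign; the
    identity holds at u = 0 too, as ln vanishes on nonpositive numbers. *)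
Lemma is_derive_ln_norm_affine (c d t0 : R) : c != 0 ->
  is_derive t0 1 (fun t => ln `|c + (t - t0) * d|) (d / c).
Proof.
move=> c0.
have -> : (fun t => ln `|c + (t - t0) * d|)
  = (fun t => 2^-1 * ln ((c + (t - t0) * d) ^+ 2)).
  apply/funext => t; rewrite -real_normK ?num_real //.
  have [->|u0] := eqVneq (c + (t - t0) * d) 0.
    by rewrite normr0 expr0n /= !ln0 // mulr0.
  by rewrite lnXn ?normr_gt0 // mulr2n; field.
have h : is_derive t0 1 (fun t => ln ((c + (t - t0) * d) ^+ 2)) (2 * (d / c)).
  have -> : 2 * (d / c) = (c ^+ 2)^-1 * (2 * c * d) by field.
  apply: (@is_derive1_comp R (@ln R) (fun t => (c + (t - t0) * d) ^+ 2)).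
    rewrite subrr mul0r addr0; apply: is_derive1_ln.
    by rewrite exprn_even_gt0.
  have ha := is_derive_affine c d t0.
  apply: is_derive_eq.
  by rewrite /GRing.scale /= subrr; ring.
have -> : d / c = 2^-1 * (2 * (d / c)) by field.
exact: is_deriveZ.
Qed.

Lemma continuous_sum_seq (T : topologicalType) (x : T) (I : eqType)
    (r : seq I) (P : pred I) (h : I -> T -> R) :
  (forall i, i \in r -> P i -> {for x, continuous (h i)}) ->
  {for x, continuous (fun t => \sum_(i <- r | P i) h i t)}.
Proof.
elim: r => [|i r IH] hr.
  rewrite (_ : (fun _ => _) = cst 0); first exact: cst_continuous.
  by apply/funext => t; rewrite big_nil.
have {}IH := IH (fun j jr => hr j (@mem_behead _ (i :: r) j jr)).
have := hr i (mem_head i r); case Pi : (P i) => hi.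
  rewrite (_ : (fun _ => _) = fun t => h i t + \sum_(j <- r | P j) h j t).
    exact: continuousD (hi isT) IH.
  by apply/funext => t; rewrite big_cons Pi.
rewrite (_ : (fun _ => _) = fun t => \sum_(j <- r | P j) h j t) //.
by apply/funext => t; rewrite big_cons Pi.
Qed.

End Preliminaries.

(** * Affine minorants of the Hamiltonian *)

Section GelfandTsetlin.
Variables (R : realType) (N : nat) (z a : N.-tuple R).
Implicit Types (Y : gt_array R N) (p : gt_pos N) (k : nat).

Definition level Y k (i : 'I_k) : R := gt_entry z Y k i.
Arguments level : clear implicits.

Arguments level : clear implicits.

Local Notation drift k := ((a`_k.-1 - a`_k) / 2).

Lemma level_interlaced Y k : open_gt_polytope z Y -> (1 <= k < N)%N ->
  interlaced (level Y k) (level Y k.+1).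
Proof.
move=> PY kN.
by apply: (@interlaced_of_adjacent R k (gt_entry z Y k) (gt_entry z Y k.+1)) =>
  i; exact: PY.
Qed.

Lemma hamiltonian_levels Y : effective_hamiltonian z a Y =
  \sum_(1 <= k < N) (log_vandermonde (level Y k)
    - 2^-1 * log_cross (level Y k) (level Y k.+1)
    - drift k * \sum_i level Y k i).
Proof. by []. Qed.

Lemma sum_vandermonde_telescope Y : (1 <= N)%N ->
  \sum_(1 <= k < N)
    (log_vandermonde (level Y k.+1) - log_vandermonde (level Y k))
  = log_vandermonde (tnth z).
Proof.
move=> N0; rewrite (telescope_sumr (fun k => log_vandermonde (level Y k))) //.
have -> : log_vandermonde (level Y 1) = 0.
  by rewrite /log_vandermonde !big_ord1_cond /=.
rewrite subr0; apply: eq_bigr => i _; apply: eq_bigr => j _.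
by rewrite /level !gt_entry_top.
Qed.

(** The form that shows convexity: half of log Delta(y^k) goes to each of
    the two pairs of levels that contain y^k. *)
Lemma hamiltonian_cauchy Y : (1 <= N)%N -> effective_hamiltonian z a Y =
  \sum_(1 <= k < N) (2^-1 * log_cauchy (level Y k) (level Y k.+1)
    - drift k * \sum_i level Y k i) - 2^-1 * log_vandermonde (tnth z).
Proof.
move=> N0; rewrite hamiltonian_levels -(sum_vandermonde_telescope Y N0) mulr_sumr -sumrB.
by apply: eq_bigr => k _; rewrite /log_cauchy; field.
Qed.

(** The form that shows coercivity: all of log Delta(y^k) goes to the pair
    (k - 1, k), which turns each pair into a sum of logarithms of weights. *)
Lemma hamiltonian_weight Y : (1 <= N)%N -> open_gt_polytope z Y ->
  effective_hamiltonian z a Y =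
  \sum_(1 <= k < N) (- 2^-1 * (\sum_q ln (weight (level Y k) (level Y k.+1) q))
    - drift k * \sum_i level Y k i) - log_vandermonde (tnth z).
Proof.
move=> N0 PY; rewrite hamiltonian_levels -(sum_vandermonde_telescope Y N0) -sumrB.
apply: eq_big_nat => k kN; rewrite sum_ln_weight; last exact: level_interlaced.
by field.
Qed.

Definition unit_entry p k i : R :=
  ((tag p == k :> nat) && (tagged p == i :> nat))%:R.

(** Entries are affine in the array, so that linear forms in the entries
    can be written as linear forms in the coordinates. *)
Lemma gt_entryB Y Y' k i :
  gt_entry z Y' k i - gt_entry z Y k i = \sum_p (Y' p - Y p) * unit_entry p k i.
Proof.
rewrite /gt_entry; case: insubP => [k' kN ek|kN]; last first.
  rewrite subrr big1 // => p _; rewrite /unit_entry.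
  case: eqP => [e|]; last by rewrite mulr0.
  by rewrite -e ltn_ord in kN.
case: insubP => [i' ik ei|ik]; last first.
  rewrite subrr big1 // => -[k2 i2] _; rewrite /unit_entry /=.
  case: eqP => [e|]; last by rewrite mulr0.
  case: eqP => [e'|]; last by rewrite mulr0.
  by move: ik; rewrite /= ek -e -e' ltn_ord.
rewrite (bigD1 (Tagged (fun k : 'I_N => 'I_k) i')) //= big1 => [|[k2 i2] ne].
  by rewrite /unit_entry /= (introT eqP ek) (introT eqP ei) mulr1 addr0.
rewrite /unit_entry /=.
case: eqP => [e|]; last by rewrite mulr0.
case: eqP => [e'|]; last by rewrite mulr0.
case/negP: ne; have ekk := val_inj (etrans ek (esym e)).
by subst k2; rewrite (val_inj (etrans e' (esym ei))).
Qed.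

(** The coordinates of the linear form obtained from the coupling through
    log t <= t - 1. *)
Definition subgradient Y p :=
  \sum_(1 <= k < N) (
    - 2^-1 * (\sum_i \sum_j coupling (level Y k) (level Y k.+1) i j
        * ((unit_entry p k i - unit_entry p k.+1 j)
            / (level Y k i - level Y k.+1 j)))
    - drift k * \sum_(i < k) unit_entry p k i).

Definition level_ratio Y Y' k (i : 'I_k) (j : 'I_k.+1) :=
  (level Y' k i - level Y' k.+1 j) / (level Y k i - level Y k.+1 j).

(** What is lost by replacing log t with t - 1. *)
Definition excess Y Y' :=
  \sum_(1 <= k < N) \sum_i \sum_j coupling (level Y k) (level Y k.+1) i j
    * (level_ratio Y Y' i j - 1 - ln (level_ratio Y Y' i j)).

Lemma level_neq Y k (i : 'I_k) (j : 'I_k.+1) :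
  open_gt_polytope z Y -> (1 <= k < N)%N -> level Y k i - level Y k.+1 j != 0.
Proof.
by move=> PY kN; rewrite subr_eq0 (interlaced_neq (level_interlaced PY kN)).
Qed.

Lemma level_ratio_gt0 Y Y' k (i : 'I_k) (j : 'I_k.+1) :
  open_gt_polytope z Y -> open_gt_polytope z Y' -> (1 <= k < N)%N ->
  0 < level_ratio Y Y' i j.
Proof.
move=> PY PY' kN; rewrite /level_ratio.
have := level_interlaced PY kN i j; have := level_interlaced PY' kN i j.
case: ifP => _ h h'; last by rewrite divr_gt0 // subr_gt0.
by rewrite -mulrNN -invrN divr_gt0 // oppr_gt0 subr_lt0.
Qed.

Lemma sum_subgradient Y Y' : open_gt_polytope z Y ->
  \sum_p subgradient Y p * (Y' p - Y p) =
  \sum_(1 <= k < N) (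
    - 2^-1 * (\sum_i \sum_j coupling (level Y k) (level Y k.+1) i j
        * (level_ratio Y Y' i j - 1))
    - drift k * (\sum_i level Y' k i - \sum_i level Y k i)).
Proof.
move=> PY; under [LHS]eq_bigr do rewrite mulr_suml.
rewrite exchange_big; apply: eq_big_nat => k kN /=.
under [LHS]eq_bigr do rewrite mulrBl.
rewrite sumrB; congr (_ - _); last first.
  under [LHS]eq_bigr do rewrite -(mulrA (drift k)).
  rewrite -mulr_sumr; congr (_ * _).
  under [LHS]eq_bigr do rewrite mulr_suml.
  rewrite exchange_big -sumrB; apply: eq_bigr => i _ /=.
  by rewrite /level gt_entryB; apply: eq_bigr => p _; rewrite mulrC.
under [LHS]eq_bigr do rewrite -(mulrA (- 2^-1)).
rewrite -mulr_sumr; congr (_ * _).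
under [LHS]eq_bigr do rewrite mulr_suml.
rewrite exchange_big; apply: eq_bigr => i _ /=.
under [LHS]eq_bigr do rewrite mulr_suml.
rewrite exchange_big; apply: eq_bigr => j _ /=.
under [LHS]eq_bigr do rewrite -(mulrA (coupling _ _ _ _)).
rewrite -mulr_sumr; congr (_ * _).
have d0 := level_neq i j PY kN.
have -> : level_ratio Y Y' i j - 1 = ((level Y' k i - level Y k i)
    - (level Y' k.+1 j - level Y k.+1 j)) / (level Y k i - level Y k.+1 j).
  by rewrite /level_ratio; field.
rewrite /level !gt_entryB -sumrB mulr_suml; apply: eq_bigr => p _.
by ring.
Qed.

(** Here [log_cauchy_ge] is summed over the levels, and log t is written as
    t - 1, which is affine in the second array, minus a nonnegative rest. *)
Lemma hamiltonian_subgradient Y Y' : (1 <= N)%N ->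
  open_gt_polytope z Y -> open_gt_polytope z Y' ->
  effective_hamiltonian z a Y + \sum_p subgradient Y p * (Y' p - Y p)
    + 2^-1 * excess Y Y' <= effective_hamiltonian z a Y'.
Proof.
move=> N0 PY PY'; rewrite !hamiltonian_cauchy // sum_subgradient // /excess.
pose A V k := 2^-1 * log_cauchy (level V k) (level V k.+1)
  - drift k * \sum_i level V k i.
pose B k (i : 'I_k) j := coupling (level Y k) (level Y k.+1) i j.
pose S k := - 2^-1 * (\sum_i \sum_j B k i j * (level_ratio Y Y' i j - 1))
    - drift k * (\sum_i level Y' k i - \sum_i level Y k i).
pose E k := \sum_i \sum_j B k i j
  * (level_ratio Y Y' i j - 1 - ln (level_ratio Y Y' i j)).
suff : \sum_(1 <= k < N) (A Y k + S k + 2^-1 * E k) <= \sum_(1 <= k < N) A Y' k.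
  by rewrite 2!big_split -mulr_sumr /= /A /S /E /B; lra.
apply: ler_sum_nat => k kN.
have := log_cauchy_ge (level_interlaced PY kN) (level_interlaced PY' kN).
have -> : E k = \sum_i \sum_j B k i j * (level_ratio Y Y' i j - 1)
  - \sum_i \sum_j B k i j * ln (level_ratio Y Y' i j).
  rewrite -sumrB; apply: eq_bigr => i _; rewrite -sumrB.
  by apply: eq_bigr => j _; rewrite mulrBr.
by rewrite /A /S /B /level_ratio; lra.
Qed.

Lemma excess_term_ge0 Y Y' k (i : 'I_k) (j : 'I_k.+1) :
  open_gt_polytope z Y -> open_gt_polytope z Y' -> (1 <= k < N)%N ->
  0 <= coupling (level Y k) (level Y k.+1) i j
    * (level_ratio Y Y' i j - 1 - ln (level_ratio Y Y' i j)).
Proof.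
move=> PY PY' kN; rewrite mulr_ge0 //.
  by rewrite ltW // coupling_gt0 //; exact: level_interlaced.
by rewrite subr_ge0 ln_le_sub1 // level_ratio_gt0.
Qed.

Lemma excess_ge0 Y Y' : open_gt_polytope z Y -> open_gt_polytope z Y' ->
  0 <= excess Y Y'.
Proof.
move=> PY PY'; rewrite /excess big_nat; apply: sumr_ge0 => k kN.
by apply: sumr_ge0 => i _; apply: sumr_ge0 => j _; apply: excess_term_ge0.
Qed.

Lemma gt_array_eq Y Y' :
  (forall k i, (1 <= k < N)%N -> (i < k)%N ->
    gt_entry z Y' k i = gt_entry z Y k i) -> Y' = Y.
Proof.
move=> e; apply/ffunP => -[k i].
have k0 : (0 < k)%N by case: (nat_of_ord k) i => [[]|].
by have := e k i; rewrite k0 !ltn_ord !gt_entry_lower; apply.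
Qed.

(** If nothing is lost then all ratios are 1, so the differences between
    consecutive levels agree; the top rows agree, hence so do all levels, going
    down. *)
Lemma excess_eq0 Y Y' : open_gt_polytope z Y -> open_gt_polytope z Y' ->
  excess Y Y' = 0 -> Y' = Y.
Proof.
move=> PY PY' e0.
have ratio1 k (i : 'I_k) (j : 'I_k.+1) : (1 <= k < N)%N ->
    level_ratio Y Y' i j = 1.
  move=> kN; move/eqP: e0; rewrite /excess big_nat psumr_eq0; last first.
    move=> {i j kN} k kN.
    by apply: sumr_ge0 => i _; apply: sumr_ge0 => j _; apply: excess_term_ge0.
  move/allP/(_ k); rewrite mem_index_iota kN => /(_ isT) /=.
  rewrite psumr_eq0; last first.
    by move=> {j} i _; apply: sumr_ge0 => j _; apply: excess_term_ge0.
  move=> /allP/(_ i); rewrite mem_index_enum => /(_ isT) /=.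
  rewrite psumr_eq0; last first.
    by move=> j0 _; apply: excess_term_ge0.
  move=> /allP/(_ j); rewrite mem_index_enum => /(_ isT) /=.
  rewrite mulf_eq0 gt_eqF ?coupling_gt0 //=; last exact: level_interlaced.
  rewrite subr_eq0 => /eqP e; apply/eqP; apply: contraT => ne.
  by have := ln_lt_sub1 (level_ratio_gt0 i j PY PY' kN) ne; rewrite e ltxx.
have eq_level d k i : (k + d = N)%N -> (0 < k)%N -> (i < k)%N ->
    gt_entry z Y' k i = gt_entry z Y k i.
  elim: d k i => [|d IH] k i; first rewrite addn0 => ->.
    by move=> _ iN; rewrite !(gt_entry_top z _ (Ordinal iN)).
  move=> kd k0 ik; have kN : (1 <= k < N)%N.
    by rewrite k0 -kd -addn1 leq_add2l.
  have := ratio1 k (Ordinal ik) ord0 kN.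
  have := level_neq (Ordinal ik) ord0 PY kN.
  rewrite /level_ratio => d0 /(congr1 (fun t => t * (level Y k (Ordinal ik)
    - level Y k.+1 ord0))).
  rewrite divfK // mul1r /level /= (IH k.+1 0%N) ?addSnnS //.
  by move/addIr.
apply: gt_array_eq => k i /andP[k0 kN] ik.
by apply: (eq_level (N - k)%N) => //; rewrite subnKC // ltnW.
Qed.

(** * Partial derivatives and critical points *)

Lemma gt_entry_update Y p t k i :
  gt_entry z (gt_update Y p t) k i =
  gt_entry z Y k i + (t - Y p) * unit_entry p k i.
Proof.
apply/eqP; rewrite addrC -subr_eq gt_entryB (bigD1 p) //= big1 ?addr0.
  by rewrite ffunE eqxx.
by move=> q qp; rewrite ffunE (negbTE qp) subrr mul0r.
Qed.

Definition partial Y p :=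
  \sum_(1 <= k < N)
    (\sum_(i < k) \sum_(j < k | (i < j)%N)
        (unit_entry p k i - unit_entry p k j) / (level Y k i - level Y k j)
     - 2^-1 * \sum_(i < k) \sum_(j < k.+1)
        (unit_entry p k i - unit_entry p k.+1 j)
          / (level Y k i - level Y k.+1 j)
     - drift k * \sum_(i < k) unit_entry p k i).

Lemma level_decr Y k (i j : 'I_k) : open_gt_polytope z Y -> (1 <= k < N)%N ->
  (i < j)%N -> level Y k j < level Y k i.
Proof.
by move=> PY kN; apply: interlaced_lower_decr (level_interlaced PY kN) _ _.
Qed.

Lemma is_derive_hamiltonian Y p : open_gt_polytope z Y ->
  is_derive (Y p) 1 (fun t => effective_hamiltonian z a (gt_update Y p t))
    (partial Y p).
Proof.
move=> PY; rewrite /effective_hamiltonian /partial.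
have diffE t k l i j : gt_entry z (gt_update Y p t) k i
    - gt_entry z (gt_update Y p t) l j
  = (gt_entry z Y k i - gt_entry z Y l j)
    + (t - Y p) * (unit_entry p k i - unit_entry p l j).
  by rewrite !gt_entry_update; ring.
apply: is_derive_big => k; rewrite mem_index_iota => kN _.
apply: is_deriveB; last first.
  apply: is_deriveZ; apply: is_derive_big => i _ _.
  apply: is_derive_ext (is_derive_affine (level Y k i) _ _) _ => t.
  by rewrite gt_entry_update.
apply: is_deriveB; last first.
  apply: is_deriveZ; apply: is_derive_big => i _ _.
  apply: is_derive_big => j _ _.
  apply: is_derive_ext (is_derive_ln_norm_affine _ _ (level_neq i j PY kN)) _.
  by move=> t; rewrite diffE.
apply: is_derive_big => i _ _; apply: is_derive_big => j _ ij.
have d0 : 0 < level Y k i - level Y k j by rewrite subr_gt0; apply: level_decr.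
apply: is_derive_ext (is_derive_ln_affine _ _ d0) _.
by move=> t; rewrite diffE.
Qed.

(** The polytope is open along coordinate lines: moving one entry by less
    than the smallest gap keeps all gaps positive. *)
Lemma polytope_update Y p : open_gt_polytope z Y -> exists2 e, 0 < e &
  forall t, `|t - Y p| < e -> open_gt_polytope z (gt_update Y p t).
Proof.
move=> PY.
pose y := gt_entry z Y.
pose gap (q : gt_pos N) : R := let k := tag q in let i := tagged q in
  Num.min (y k.+1 i - y k i) (y k i - y k.+1 i.+1).
have gap0 q : 0 < gap q.
  case: q => k i; rewrite /gap /= lt_min !subr_gt0.
  have k0 : (0 < k)%N by case: (nat_of_ord k) i => [[]|].
  by have [] := PY k i; rewrite ?k0 ?ltn_ord // => -> ->.
have [e e0 egap] := exists_lower_bound gap0.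
exists e => // t te; rewrite /open_gt_polytope /= => k i kN ik.
rewrite !gt_entry_update -/y.
have [k0 kN'] := andP kN.
have := egap (Tagged (fun k : 'I_N => 'I_k) (Ordinal ik : 'I_(Ordinal kN'))).
rewrite /gap /= le_min => /andP[h1 h2].
have unit01 q r : `|unit_entry p q r - unit_entry p k i| <= 1.
  rewrite /unit_entry; do 2 case: (_ && _);
  by rewrite ?subrr ?subr0 ?sub0r ?normrN ?normr1 ?normr0.
have small q r : `|(t - Y p) * (unit_entry p q r - unit_entry p k i)| < e.
  by rewrite normrM; apply: le_lt_trans te; rewrite ler_piMr.
have := small k.+1 i; have := small k.+1 i.+1.
by rewrite !ltr_norml !mulrBr => /andP[? ?] /andP[? ?]; split; lra.
Qed.

Lemma gt_update_id Y p : gt_update Y p (Y p) = Y.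
Proof. by apply/ffunP => q; rewrite ffunE; case: eqP => [->|]. Qed.

Lemma gt_update_update Y p s t :
  gt_update (gt_update Y p s) p t = gt_update Y p t.
Proof. by apply/ffunP => q; rewrite !ffunE; case: eqP. Qed.

Lemma gt_update_at Y p t : gt_update Y p t p = t.
Proof. by rewrite ffunE eqxx. Qed.

(** Fermat's rule, for the difference of the Hamiltonian and its affine
    minorant of slope c. *)
Lemma partial_of_min Y p c : open_gt_polytope z Y ->
  (forall t, open_gt_polytope z (gt_update Y p t) ->
    effective_hamiltonian z a Y + c * (t - Y p) <=
    effective_hamiltonian z a (gt_update Y p t)) ->
  partial Y p = c.
Proof.
move=> PY minY; have [e e0 Pe] := polytope_update p PY.
pose h t := effective_hamiltonian z a (gt_update Y p t) + (0 + (t - Y p) * - c).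
have dh t : `|t - Y p| < e -> is_derive t 1 h (partial (gt_update Y p t) p - c).
  move=> te; apply: is_deriveD.
    have := is_derive_hamiltonian p (Pe _ te).
    rewrite gt_update_at => d; apply: is_derive_ext d _ => s.
    by rewrite gt_update_update.
  rewrite (_ : (fun _ => _) = fun s => (t - Y p) * - c + (s - t) * - c).
    exact: is_derive_affine.
  by apply/funext => s; ring.
have inE t : t \in `](Y p - e), (Y p + e)[%R -> `|t - Y p| < e.
  by rewrite in_itv /= ltr_norml => /andP[? ?]; apply/andP; split; lra.
have : is_derive (Y p) 1 h 0.
  apply: (@derive1_at_min _ h (Y p - e) (Y p + e)).
  - by lra.
  - by move=> t /inE /dh [].
  - by rewrite in_itv /=; apply/andP; split; lra.
  - move=> t /inE /Pe /minY; rewrite /h gt_update_id subrr mul0r !addr0 add0r.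
    by rewrite mulrN mulrC; lra.
have : is_derive (Y p) 1 h (partial Y p - c).
  by have := dh (Y p); rewrite gt_update_id subrr normr0; apply.
by move=> [_ d1] [_ d2]; apply/eqP; rewrite -subr_eq0 -(etrans (esym d1) d2).
Qed.

Lemma sum_update Y p t (L : gt_pos N -> R) :
  \sum_q L q * (gt_update Y p t q - Y q) = L p * (t - Y p).
Proof.
rewrite (bigD1 p) //= big1 ?addr0 => [|q qp]; rewrite ffunE ?eqxx //.
by rewrite (negbTE qp) subrr mulr0.
Qed.

(** This identifies the gradient without computing it: both are slopes of
    affine functions below the Hamiltonian. *)
Lemma partial_subgradient Y p : (1 <= N)%N -> open_gt_polytope z Y ->
  partial Y p = subgradient Y p.
Proof.
move=> N0 PY; apply: partial_of_min => // t Pt.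
have := hamiltonian_subgradient N0 PY Pt; rewrite sum_update.
by have := excess_ge0 PY Pt; lra.
Qed.

Lemma critical_partial Y : open_gt_polytope z Y ->
  is_critical_point (effective_hamiltonian z a) Y <-> forall p, partial Y p = 0.
Proof.
move=> PY; split=> [cY p|p0 p].
  by have [_ e1] := cY p; have [_ <-] := is_derive_hamiltonian p PY.
by rewrite -(p0 p); exact: is_derive_hamiltonian.
Qed.

Lemma critical_lt Y Y' : (1 <= N)%N -> open_gt_polytope z Y ->
  (forall p, partial Y p = 0) -> open_gt_polytope z Y' -> Y' <> Y ->
  effective_hamiltonian z a Y < effective_hamiltonian z a Y'.
Proof.
move=> N0 PY p0 PY' ne; have := hamiltonian_subgradient N0 PY PY'.
rewrite big1 ?addr0 => [|p _]; last by rewrite -partial_subgradient // p0 mul0r.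
apply: lt_le_trans; rewrite ltrDl mulr_gt0 ?invr_gt0 //.
rewrite lt0r excess_ge0 // andbT; apply/eqP => /excess_eq0 e.
by apply: ne; exact: e.
Qed.

Lemma minimizer_partial Y :
  is_global_minimizer (open_gt_polytope z) (effective_hamiltonian z a) Y ->
  forall p, partial Y p = 0.
Proof.
move=> [PY minY] p; apply: partial_of_min => // t Pt.
by rewrite mul0r addr0 minY.
Qed.

(** * The equations of the corners lattice *)

(** Only the levels k - 1 and k of the sum involve the entry (k, i). *)
Lemma partialE Y p k i : (1 <= k < N)%N -> (i < k)%N ->
  (forall l j, unit_entry p l j = ((k == l) && (i == j))%:R) ->
  partial Y p =
  \sum_(j < k | j != i :> nat) (gt_entry z Y k i - gt_entry z Y k j)^-1
  - 2^-1 * \sum_(q < k.+1) (gt_entry z Y k i - gt_entry z Y k.+1 q)^-1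
  - 2^-1 * \sum_(r < k.-1) (gt_entry z Y k i - gt_entry z Y k.-1 r)^-1
  - drift k.
Proof.
move=> kN ik pE.
pose A l := \sum_(i < l) \sum_(j < l | (i < j)%N)
        (unit_entry p l i - unit_entry p l j) / (level Y l i - level Y l j).
pose B l := \sum_(i < l) \sum_(j < l.+1)
        unit_entry p l i / (level Y l i - level Y l.+1 j).
pose C l := \sum_(i < l) \sum_(j < l.+1)
        unit_entry p l.+1 j / (level Y l i - level Y l.+1 j).
pose D l := drift l * \sum_(i < l) unit_entry p l i.
have unit0 l j : l != k -> unit_entry p l j = 0.
  by rewrite pE eq_sym => /negbTE ->.
have unitk j : unit_entry p k j = (i == j)%:R by rewrite pE eqxx.
have A0 l : l != k -> A l = 0.
  move=> lk; apply: big1 => s _; apply: big1 => t _.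
  by rewrite !unit0 // subrr mul0r.
have B0 l : l != k -> B l = 0.
  by move=> lk; apply: big1 => s _; apply: big1 => t _; rewrite unit0 // mul0r.
have C0 l : l.+1 != k -> C l = 0.
  by move=> lk; apply: big1 => s _; apply: big1 => t _; rewrite unit0 // mul0r.
have D0 l : l != k -> D l = 0.
  by move=> lk; rewrite /D big1 ?mulr0 // => t _; rewrite unit0.
have BC l : \sum_(s < l) \sum_(t < l.+1)
    (unit_entry p l s - unit_entry p l.+1 t) / (level Y l s - level Y l.+1 t)
  = B l - C l.
  rewrite -sumrB; apply: eq_bigr => s _; rewrite -sumrB; apply: eq_bigr => t _.
  by rewrite mulrBl.
have -> : partial Y p = \sum_(1 <= l < N) A l - 2^-1 * \sum_(1 <= l < N) B l
    + 2^-1 * \sum_(1 <= l < N) C l - \sum_(1 <= l < N) D l.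
  transitivity (\sum_(1 <= l < N) (A l - 2^-1 * B l + 2^-1 * C l - D l)).
    by apply: eq_bigr => l _; rewrite -/(A l) -/(D l) BC; ring.
  by rewrite sumrB big_split sumrB /= !mulr_sumr.
rewrite (sum_nat_single (f := A) kN) => [|l _]; last exact: A0.
rewrite (sum_nat_single (f := B) kN) => [|l _]; last exact: B0.
rewrite (sum_nat_single (f := D) kN) => [|l _]; last exact: D0.
congr (_ - _ + _ - _).
- rewrite /A; under eq_bigr do under eq_bigr do rewrite !unitk.
  exact: (sum_pair_unit _ ik).
- congr (_ * _); rewrite /B.
  under eq_bigr do rewrite -mulr_sumr unitk.
  exact: (sum_unit _ ik).
- rewrite -mulrN; congr (_ * _).
  (* For k = 1 there is no level below, and no term of C survives. *)
  case: k kN ik pE unit0 unitk A0 B0 C0 D0 => // -[|m] kN ik pE _ unitk _ _ C0 _.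
    rewrite big_ord0 oppr0 big_nat big1 // => l /andP[l0 _].
    by apply: C0; rewrite gtn_eqF // ltnS.
  rewrite (@sum_nat_single R 1 N m.+1) => [||l _ lm]; last 2 first.
  + by rewrite /= ltnW //; case/andP: kN.
  + by apply: C0; rewrite eqSS.
  rewrite /C -sumrN; apply: eq_bigr => s _.
  under eq_bigr do rewrite unitk.
  by rewrite (sum_unit _ ik) /= -invrN opprB.
- rewrite /D; under eq_bigr do rewrite unitk -[_%:R]mulr1.
  by rewrite (sum_unit (fun=> 1) ik) mulr1.
Qed.

Lemma corners_partial Y :
  corners_equations z a Y <-> forall p, partial Y p = 0.
Proof.
have unitE (k : 'I_N) (i : 'I_k) l j :
    unit_entry (Tagged (fun k : 'I_N => 'I_k) i) l j
    = ((k == l :> nat) && (i == j :> nat))%:R.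
  by [].
split=> [cY [k i]|p0].
  have k0 : (0 < k)%N by case: (nat_of_ord k) i => [[]|].
  have kN : (1 <= k < N)%N by rewrite k0 ltn_ord.
  by rewrite (partialE Y kN (ltn_ord i) (unitE k i)) (cY k i kN (ltn_ord i)) subrr.
rewrite /corners_equations /= => k i kN ik; have [k0 kN'] := andP kN.
have := p0 (Tagged (fun k : 'I_N => 'I_k) (Ordinal ik : 'I_(Ordinal kN'))).
by rewrite (partialE Y kN ik) // => /eqP; rewrite subr_eq0 => /eqP.
Qed.

(** * Existence of a minimizer *)

Lemma polytope_bounded Y k i : open_gt_polytope z Y -> (0 < k <= N)%N ->
  (i < k)%N -> `|gt_entry z Y k i| <= \sum_(j < N) `|tnth z j|.
Proof.
move=> PY /andP[k0 kN]; rewrite -(subKn kN).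
have : (0 < N - (N - k))%N by rewrite subKn.
elim: (N - k)%N i => [|d IH] i.
  rewrite subn0 => _ iN; rewrite (gt_entry_top z Y (Ordinal iN)).
  by rewrite (bigD1 (Ordinal iN)) //= lerDl sumr_ge0.
move=> d0 id; have dN : (d < N)%N by rewrite -subn_gt0 (leq_trans d0) ?leq_sub2l.
have e : (N - d)%N = (N - d.+1).+1 by rewrite -subnSK.
have lN : (1 <= N - d.+1 < N)%N by rewrite d0 -subn_gt0 subKn.
have [u l] := PY _ _ lN id; rewrite e in IH.
have := IH i isT (leqW id).
have := IH i.+1 isT id.
by rewrite !ler_norml => /andP[? ?] /andP[? ?]; apply/andP; split; lra.
Qed.

(** Each level can be taken to consist of the midpoints of the level above. *)
Lemma polytope_nonempty :
  (forall i j : 'I_N, (i < j)%N -> tnth z j < tnth z i) ->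
  exists Y, open_gt_polytope z Y.
Proof.
move=> hz.
(* m d is the level N - d. *)
pose m d : nat -> R := iter d (fun y i => (y i + y i.+1) / 2) (fun i => z`_i).
have mdecr d i : (i.+1 < N - d)%N -> m d i.+1 < m d i.
  elim: d i => [|d IH] i iN.
    rewrite subn0 in iN; rewrite /m /=.
    by have := hz (Ordinal (ltnW iN)) (Ordinal iN); rewrite !(tnth_nth 0); apply.
  rewrite /m /= -/(m d).
  have h1 : (i.+2 < N - d)%N by rewrite -ltn_predRL -subnS.
  by have := IH _ h1; have := IH _ (ltnW h1); lra.
pose Y : gt_array R N := [ffun p : gt_pos N => m (N - tag p)%N (tagged p)].
have YE k i : (k <= N)%N -> (i < k)%N -> gt_entry z Y k i = m (N - k)%N i.
  rewrite leq_eqVlt => /orP[/eqP -> iN|kN ik].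
    by rewrite (gt_entry_top z Y (Ordinal iN)) (tnth_nth 0) subnn.
  have := gt_entry_lower z Y (Ordinal ik : 'I_(Ordinal kN)).
  by rewrite /Y /= => ->; rewrite ffunE.
exists Y; rewrite /open_gt_polytope /= => k i /andP[k0 kN] ik.
rewrite !YE ?(ltnW kN) ?(leqW ik) // -(subnSK kN).
have := mdecr (N - k.+1)%N i; rewrite subKn // ltnS => /(_ ik).
by rewrite /m /= -/(m _); split; lra.
Qed.

(** A single log w is bounded by the sum of all of them, since they have the
    same sign. *)
Lemma sublevel_weight h : (1 <= N)%N -> exists2 e, 0 < e &
  forall Y, open_gt_polytope z Y -> effective_hamiltonian z a Y <= h ->
  forall k (q : 'I_k.+1), (1 <= k < N)%N ->
    e <= weight (level Y k) (level Y k.+1) q.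
Proof.
move=> N0.
pose M := \sum_(j < N) `|tnth z j|.
pose C := \sum_(1 <= k < N) `|drift k| * (\sum_(i < k) M).
exists (expR (- 2 * (h + C + log_vandermonde (tnth z)))); first exact: expR_gt0.
move=> Y PY; rewrite hamiltonian_weight // sumrB => Hh k q kN.
have w0 l (r : 'I_l.+1) : (1 <= l < N)%N -> 0 < weight (level Y l) (level Y l.+1) r.
  by move=> lN; apply: weight_gt0; apply: level_interlaced.
rewrite -[leRHS]lnK ?posrE ?w0 // ler_expR.
have lw l (r : 'I_l.+1) : (1 <= l < N)%N ->
    0 <= - ln (weight (level Y l) (level Y l.+1) r).
  by move=> lN; rewrite oppr_ge0 ln_le0 // weight_le1 //; apply: level_interlaced.
have driftC : \sum_(1 <= k < N) drift k * \sum_(i < k) level Y k i <= C.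
  apply: ler_sum_nat => l /andP[l0 lN]; apply: le_trans (ler_norm _) _.
  rewrite normrM ler_wpM2l //; apply: le_trans (ler_norm_sum _ _ _) _.
  apply: ler_sum => i _; apply: polytope_bounded => //.
  by rewrite l0 ltnW.
suff : - 2^-1 * ln (weight (level Y k) (level Y k.+1) q) <=
  \sum_(1 <= k < N) - 2^-1 * (\sum_q ln (weight (level Y k) (level Y k.+1) q)).
  by lra.
have term_ge0 l : (1 <= l < N)%N ->
    0 <= - 2^-1 * (\sum_q ln (weight (level Y l) (level Y l.+1) q)).
  move=> lN; rewrite mulNr -mulrN -sumrN mulr_ge0 ?invr_ge0 // sumr_ge0 // => r _.
  exact: lw.
rewrite (bigD1_seq k) ?mem_index_iota ?iota_uniq //= [X in _ + X]big_seq_cond.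
apply: ler_wpDr.
  apply: sumr_ge0 => l /andP[lN _]; apply: term_ge0.
  by rewrite mem_index_iota in lN.
rewrite (bigD1 q) //= mulrDr lerDl mulNr -mulrN -sumrN mulr_ge0 ?invr_ge0 //.
by apply: sumr_ge0 => r _; apply: lw.
Qed.

(** The weights of y_i and y_(i+1) are at most (y_i - x_i) / (y_i - y_(i+1))
    and (x_i - y_(i+1)) / (y_i - y_(i+1)), so that both gaps around x_i
    are at least e times the gap above it, and in turn bound the gaps of the
    level x. *)
Lemma weight_gap Y e d : open_gt_polytope z Y -> 0 < e -> 0 <= d ->
  (forall k (q : 'I_k.+1), (1 <= k < N)%N ->
    e <= weight (level Y k) (level Y k.+1) q) ->
  (forall i, (i.+1 < N)%N -> d <= z`_i - z`_i.+1) ->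
  forall k i, (1 <= k < N)%N -> (i < k)%N ->
    d * e ^+ N <= gt_entry z Y k.+1 i - gt_entry z Y k i /\
    d * e ^+ N <= gt_entry z Y k i - gt_entry z Y k.+1 i.+1.
Proof.
move=> PY e0 d0 we dz.
have step k i : (1 <= k < N)%N -> (i < k)%N ->
    e * (gt_entry z Y k.+1 i - gt_entry z Y k.+1 i.+1)
      <= gt_entry z Y k.+1 i - gt_entry z Y k i /\
    e * (gt_entry z Y k.+1 i - gt_entry z Y k.+1 i.+1)
      <= gt_entry z Y k i - gt_entry z Y k.+1 i.+1.
  move=> kN ik; have xy := level_interlaced PY kN.
  have [u l] := PY _ _ kN ik.
  have gap0 : 0 < gt_entry z Y k.+1 i - gt_entry z Y k.+1 i.+1.
    by rewrite subr_gt0 (lt_trans l).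
  split; rewrite -ler_pdivlMr //.
    apply: le_trans (we _ (Ordinal (leqW ik)) kN) _.
    apply: le_trans (weight_le_factor xy _ (Ordinal ik)) _.
    by rewrite /level /= /bump leqnn.
  apply: le_trans (we _ (Ordinal (ik : i.+1 < k.+1)%N) kN) _.
  apply: le_trans (weight_le_factor xy _ (Ordinal ik)) _.
  rewrite /level /= /bump ltnn add0n.
  by rewrite -mulrNN -invrN !opprB.
have e1 : (1 < N)%N -> e <= 1.
  move=> N1; apply: le_trans (we 1%N ord0 _) _; first by rewrite N1.
  by apply: weight_le1; apply: level_interlaced => //; rewrite N1.
(* j counts the levels below the top row. *)
have gap j i : (i.+1 < N - j)%N ->
    d * e ^+ j <= gt_entry z Y (N - j) i - gt_entry z Y (N - j) i.+1.
  elim: j i => [|j IH] i; rewrite ?subn0 ?expr0 ?mulr1 => ij.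
    have := dz i ij; have := gt_entry_top z Y (Ordinal (ltnW ij)).
    have := gt_entry_top z Y (Ordinal ij).
    by rewrite !(tnth_nth 0) /= => -> ->.
  have jN : (j < N)%N.
    by rewrite -subn_gt0 (leq_trans _ (leq_sub2l N (leqnSn j))) ?(leq_trans _ ij).
  have kN : (1 <= N - j.+1 < N)%N.
    by rewrite (leq_trans _ ij) //= -subn_gt0 subKn.
  have [_ s1] := step _ _ kN (ltnW ij).
  have [u2 _] := PY _ _ kN ij.
  have eN : (N - j)%N = (N - j.+1).+1 by rewrite -subnSK.
  have := IH i; rewrite eN => /(_ (leqW ij)) /(ler_wpM2l (ltW e0)).
  by rewrite exprSr mulrA [_ * e]mulrC; lra.
move=> k i kN ik; have [k0 kN'] := andP kN.
have := gap (N - k.+1)%N i; rewrite subKn // ltnS => /(_ ik) g.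
have [s1 s2] := step _ _ kN ik.
have : d * e ^+ N <= e * (gt_entry z Y k.+1 i - gt_entry z Y k.+1 i.+1).
  have := ler_wpM2l (ltW e0) g; apply: le_trans.
  rewrite mulrCA ler_wpM2l // -exprS.
  by apply: ler_wiXn2l; [exact: ltW|apply: e1; exact: leq_ltn_trans kN'|
    rewrite subnSK // leq_subr].
by split; lra.
Qed.

Local Open Scope classical_set_scope.

(** Arrays are identified with row vectors, on which compactness and
    continuity are available coordinatewise. *)
Definition array_of_row (v : 'rV[R]_#|{: gt_pos N}|) : gt_array R N :=
  [ffun p => v ord0 (enum_rank p)].

Definition row_of_array Y : 'rV[R]_#|{: gt_pos N}| := \row_j Y (enum_val j).

Lemma row_of_arrayK : cancel row_of_array array_of_row.
Proof. by move=> Y; apply/ffunP => p; rewrite ffunE mxE enum_rankK. Qed.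

Lemma gt_entry_continuous k i :
  continuous (fun v => gt_entry z (array_of_row v) k i : R).
Proof.
rewrite /gt_entry; case: insubP => [k' _ _|_]; last exact: cst_continuous.
case: insubP => [i' _ _|_]; last exact: cst_continuous.
set p : gt_pos N := Tagged (fun k : 'I_N => 'I_k) i'.
have -> : (fun v => array_of_row v p)
    = (fun v : 'rV[R]_#|{: gt_pos N}| => v ord0 (enum_rank p)).
  by apply/funext => v; rewrite ffunE.
exact: coord_continuous.
Qed.

Lemma hamiltonian_continuous v : open_gt_polytope z (array_of_row v) ->
  {for v, continuous (fun v => effective_hamiltonian z a (array_of_row v) : R)}.
Proof.
move=> Pv; rewrite /effective_hamiltonian.
have entry l i := @gt_entry_continuous l i v.
apply: continuous_sum_seq => k; rewrite mem_index_iota => kN _.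
apply: continuousB; last first.
  apply: continuousM; first exact: cst_continuous.
  by apply: continuous_sum_seq => i _ _; exact: entry.
apply: continuousB; last first.
  apply: continuousM; first exact: cst_continuous.
  apply: continuous_sum_seq => i _ _; apply: continuous_sum_seq => j _ _.
  apply: continuous_comp; last first.
    by apply: continuous_ln; rewrite normr_gt0; exact: level_neq.
  apply: continuous_comp; last exact: norm_continuous.
  by apply: continuousB; exact: entry.
apply: continuous_sum_seq => i _ _; apply: continuous_sum_seq => j _ ij.
apply: continuous_comp; last first.
  by apply: continuous_ln; rewrite subr_gt0; exact: level_decr.
by apply: continuousB; exact: entry.
Qed.

Definition gap_box (M d : R) : set 'rV[R]_#|{: gt_pos N}| :=
  [set v : 'rV[R]_#|{: gt_pos N}| | forall j, `[- M, M] (v ord0 j)] `&`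
  \bigcap_(ki in [set ki : nat * nat | (1 <= ki.1 < N)%N && (ki.2 < ki.1)%N])
    [set v | let y := gt_entry z (array_of_row v) in
      d <= y ki.1.+1 ki.2 - y ki.1 ki.2 /\ d <= y ki.1 ki.2 - y ki.1.+1 ki.2.+1].

Lemma gap_box_compact M d : compact (gap_box M d).
Proof.
apply: compact_closedI.
  by apply: (@rV_compact _ _ (fun=> `[- M, M])) => j; exact: segment_compact.
apply: closed_bigI => -[k i] _ /=.
have diff_cont k1 i1 k2 i2 : continuous (fun v : 'rV[R]_#|{: gt_pos N}| =>
    gt_entry z (array_of_row v) k1 i1 - gt_entry z (array_of_row v) k2 i2 : R).
  move=> v.
  exact: cvgB (@gt_entry_continuous k1 i1 v) (@gt_entry_continuous k2 i2 v).
have closed_diff k1 i1 k2 i2 : closed [set v : 'rV[R]_#|{: gt_pos N}| |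
    d <= gt_entry z (array_of_row v) k1 i1 - gt_entry z (array_of_row v) k2 i2].
  apply: (preimage_closed _ (@closed_ge _ d)) => v _.
  exact: diff_cont.
exact: (closedI (closed_diff k.+1 i k i) (closed_diff k i k.+1 i.+1)).
Qed.

Lemma gap_box_polytope M d v : 0 < d -> gap_box M d v ->
  open_gt_polytope z (array_of_row v).
Proof.
move=> d0 [_ gv]; rewrite /open_gt_polytope /= => k i kN ik.
have /= [|g1 g2] := gv (k, i); first by rewrite /= kN.
by split; rewrite -subr_gt0; [exact: lt_le_trans g1|exact: lt_le_trans g2].
Qed.

(** All arrays with a Hamiltonian at most that of a given one lie in the
    compact set where the gaps are bounded below, so a minimum over this set is
    a minimum over the polytope. *)
Lemma minimizer_exists : (1 <= N)%N ->
  (forall i j : 'I_N, (i < j)%N -> tnth z j < tnth z i) ->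
  exists Y, is_global_minimizer (open_gt_polytope z)
    (effective_hamiltonian z a) Y.
Proof.
move=> N0 hz; have [Y0 PY0] := polytope_nonempty hz.
pose h := effective_hamiltonian z a Y0.
have [e e0 we] := sublevel_weight h N0.
have [d d0 dz] : exists2 d, 0 < d &
    forall i, (i.+1 < N)%N -> d <= z`_i - z`_i.+1.
  have [|d d0 dz] := @exists_lower_bound R 'I_N
      (fun i => if (i.+1 < N)%N then z`_i - z`_i.+1 else 1).
    move=> i; case: ifPn => // iN; rewrite subr_gt0.
    by have := hz i (Ordinal iN); rewrite !(tnth_nth 0); apply.
  by exists d => // i iN; have := dz (Ordinal (ltnW iN)); rewrite /= iN.
pose K := gap_box (\sum_(j < N) `|tnth z j|) (d * e ^+ N).
have de0 : 0 < d * e ^+ N by rewrite mulr_gt0 ?exprn_gt0.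
have inK Y : open_gt_polytope z Y -> effective_hamiltonian z a Y <= h ->
    K (row_of_array Y).
  move=> PY Yh; split=> [j /=|[k i] /= /andP[kN ik]].
    rewrite mxE in_itv /= -ler_norml; case: (enum_val j) => k i.
    rewrite -(gt_entry_lower z Y i); apply: polytope_bounded => //.
    by rewrite (ltnW (ltn_ord k)) andbT; case: (nat_of_ord k) i => [[]|].
  rewrite row_of_arrayK.
  by apply: weight_gap => // [|k' q k'N]; [exact: ltW|exact: we].
have [||v vK vmin] := @compact_EVT_min _ R
    (fun v => effective_hamiltonian z a (array_of_row v)) K _ (@gap_box_compact _ _) _.
- by exists (row_of_array Y0); apply: inK.
- apply: continuous_in_subspaceT => v /set_mem vK.
  exact: hamiltonian_continuous (gap_box_polytope de0 vK).
have Pv : open_gt_polytope z (array_of_row v).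
  by apply: gap_box_polytope de0 _; exact/set_mem/vK.
have min0 Y : open_gt_polytope z Y -> effective_hamiltonian z a Y <= h ->
    effective_hamiltonian z a (array_of_row v) <= effective_hamiltonian z a Y.
  by move=> PY Yh; rewrite -(row_of_arrayK Y); apply/vmin/mem_set/inK.
exists (array_of_row v); split=> // Y PY.
have [Yh|/ltW hY] := leP (effective_hamiltonian z a Y) h; first exact: min0.
by apply: le_trans hY; apply: min0.
Qed.

End GelfandTsetlin.

Theorem proposition5p6 (R : realType) (N : nat) (z a : N.-tuple R)
    (hN : (2 <= N)%N)
    (hz : forall i j : 'I_N, (i < j)%N -> tnth z j < tnth z i) :
  exists Ybar : gt_array R N,
    [/\ unique (fun Y => open_gt_polytope z Y /\ corners_equations z a Y) Ybar,
        unique (fun Y => open_gt_polytope z Y /\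
                  is_critical_point (effective_hamiltonian z a) Y) Ybar
      & unique (is_global_minimizer (open_gt_polytope z)
                  (effective_hamiltonian z a)) Ybar].
Proof.
have N0 := ltnW hN.
have [Y minY] := minimizer_exists a N0 hz.
have PY := minY.1; have Y0 := minimizer_partial minY.
have uniq0 Y' : open_gt_polytope z Y' -> (forall p, partial z a Y' p = 0) ->
    Y = Y'.
  move=> PY' Y'0; apply: contrapT => ne.
  by have := critical_lt N0 PY' Y'0 PY ne; rewrite ltNge minY.2.
exists Y; split; split.
- by split=> //; apply/corners_partial.
- by move=> Y' [PY' /corners_partial]; exact: uniq0.
- by split=> //; apply/critical_partial.
- by move=> Y' [PY' cY']; apply: uniq0 => //; apply/critical_partial.
- by [].
- by move=> Y' minY'; apply: uniq0 minY'.1 (minimizer_partial minY').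
Qed.
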